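(* Let $0<\alpha<1$ be irrational, let $z_{-1}\in\mathbb{C}$, and let $(z_n)$ be the greedy sequence with parameters $(\alpha,z_{-1})$, with sign sequence $(\varepsilon_n)$. Then: (1) The greedy sequence with parameters $(1-\alpha,\overline{z_{-1}})$ is $(\overline{z_n})$, with signs $\varepsilon_n$. (2) The greedy sequence with parameters $(\alpha\pm 0.5 \bmod 1,\ z_{-1})$ is $(z_n)$, with signs $\varepsilon_n\cdot(-1)^n$. (3) The greedy sequence with parameters $(\alpha,-z_{-1})$ is $(-z_n)$, with signs $-\varepsilon_n$.
   Context: Greedy sequence with parameters $(\alpha,z_{-1})$, where $\alpha>0$ is irrational and $z_{-1}\in\mathbb{C}$: for $n\ge 0$, $z_n=z_{n-1}+\varepsilon_n e^{2\pi i\alpha n}$ where the sign $\varepsilon_n\in\{-1,1\}$ is chosen so as to minimize $|z_n|$. If $|z_{n-1}+e^{2\pi i\alpha n}|=|z_{n-1}-e^{2\pi i\alpha n}|$ for some $n$, the sequence terminates at $z_{n-1}$ (neither $z_n$ nor $\varepsilon_n$, nor any later term, is defined). Here $x \bmod 1$ denotes the representative of $x$ in $[0,1)$. *)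

(* Defs.v *)
From HB Require Import structures.
From mathcomp Require Import all_boot all_order all_algebra.
From mathcomp Require Import complex.
From mathcomp Require Import classical_sets reals trigo.

Set Implicit Arguments.
Unset Strict Implicit.
Unset Printing Implicit Defensive.

Import Order.TTheory GRing.Theory Num.Theory.

Local Open Scope ring_scope.
Local Open Scope complex_scope.

(* e^{i t} for real t, through Euler's formula: the libraries have no complex
   exponential. *)
Definition expi (R : realType) (t : R) : R[i] := cos t +i* sin t.

Definition mod1 (R : realType) (x : R) : R := x - (Num.floor x)%:~R.

Definition rot (R : realType) (alpha : R) (n : nat) : R[i] :=
  expi (2 * pi * alpha * n%:R).

(* z_{n-1}, where [z n] is z_n for n >= 0 and [zm1] is z_{-1}; [None] means that
   the term is not defined because the sequence has terminated. *)
Definition pred_term (R : realType) (zm1 : R[i]) (z : nat -> option R[i])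
  (n : nat) : option R[i] := if n is m.+1 then z m else Some zm1.

(* [e] is a sign minimizing |w + e u|. Norms are those of the library, which
   take values in R[i]; the order of R[i] extends that of R. *)
Definition minimizing_sign (R : realType) (w u : R[i]) (e : int) : Prop :=
  e \in [:: 1; -1] /\
  forall e' : int, e' \in [:: 1; -1] -> `|w + e%:~R * u| <= `|w + e'%:~R * u|.

Definition greedy_step (R : realType) (w u : R[i]) (zn : option R[i])
    (en : option int) : Prop :=
  (`|w + u| = `|w - u| /\ zn = None /\ en = None) \/
  (`|w + u| <> `|w - u| /\
   exists e : int, [/\ minimizing_sign w u e, en = Some e
                     & zn = Some (w + e%:~R * u)]).

(* (z, eps) is the greedy sequence with parameters (alpha, zm1), together with
   its signs. Such a pair exists and is unique for each admissible alpha, see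
   [is_greedy_exists] and [is_greedy_unique]. *)
Definition is_greedy (R : realType) (alpha : R) (zm1 : R[i])
    (z : nat -> option R[i]) (eps : nat -> option int) : Prop :=
  [/\ 0 < alpha, irrational alpha
    & forall n : nat,
        match pred_term zm1 z n with
        | Some w => greedy_step w (rot alpha n) (z n) (eps n)
        | None => z n = None /\ eps n = None
        end].

Lemma greedy_step_exists (R : realType) (w u : R[i]) :
  exists p : option R[i] * option int, greedy_step w u p.1 p.2.
Proof.
have [E|/eqP N] := eqVneq `|w + u| `|w - u|; first by exists (None, None); left.
have C : `|w + u| >=< `|w - u| by rewrite real_comparable ?normr_real.
case/orP: C => le_norm.
- exists (Some (w + 1%:~R * u), Some 1); right; split=> //; exists 1; split=> //.
  split=> // e'; rewrite !inE => /orP[]/eqP-> //.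
  by rewrite mul1r mulrNz mulN1r.
- exists (Some (w + (-1)%:~R * u), Some (-1)); right; split=> //.
  exists (-1); split=> //.
  split=> // e'; rewrite !inE => /orP[]/eqP-> //.
  by rewrite mul1r mulrNz mulN1r.
Qed.

Lemma greedy_step_unique (R : realType) (w u : R[i]) zn en zn' en' :
  greedy_step w u zn en -> greedy_step w u zn' en' -> zn = zn' /\ en = en'.
Proof.
case=> [[E [-> ->]]|[N [e [[he me] -> ->]]]];
  case=> [[E' [-> ->]]|[N' [e' [[he' me'] -> ->]]]] //.
suff -> : e = e' by [].
have := conj (me _ he') (me' _ he).
move: he he'; rewrite !inE => /orP[]/eqP-> /orP[]/eqP-> // [h1 h2].
- by case: N; move/le_anti: (introT andP (conj h1 h2));
    rewrite mul1r mulrNz mulN1r.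
- by case: N; move/le_anti: (introT andP (conj h2 h1));
    rewrite mul1r mulrNz mulN1r.
Qed.

Lemma is_greedy_unique (R : realType) (alpha : R) zm1 z eps z' eps' :
  is_greedy alpha zm1 z eps -> is_greedy alpha zm1 z' eps' ->
  z =1 z' /\ eps =1 eps'.
Proof.
move=> [_ _ h] [_ _ h'].
have step n : pred_term zm1 z n = pred_term zm1 z' n ->
    z n = z' n /\ eps n = eps' n.
  move=> E; move: (h n) (h' n); rewrite E.
  case: (pred_term _ _ _) => [w|]; first exact: greedy_step_unique.
  by move=> [-> ->] [-> ->].
have all n : z n = z' n /\ eps n = eps' n.
  by elim: n => [|n [IH _]]; apply: step.
by split=> n; have [] := all n.
Qed.

Lemma is_greedy_exists (R : realType) (alpha : R) (zm1 : R[i]) :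
  0 < alpha -> irrational alpha -> exists z eps, is_greedy alpha zm1 z eps.
Proof.
move=> a0 airr.
have [f hf] := boolp.choice (fun p : R[i] * nat =>
  greedy_step_exists p.1 (rot alpha p.2)).
pose st n w := if w is Some w0 then f (w0, n) else (None, None).
pose g := fix g n : option R[i] * option int :=
  st n (if n is m.+1 then (g m).1 else Some zm1).
exists (fun n => (g n).1), (fun n => (g n).2); split=> // n.
have -> : g n = st n (pred_term zm1 (fun n => (g n).1) n) by case: n.
by case: (pred_term _ _ _) => [w|] //=; apply: (hf (w, n)).
Qed.

(* Main.v *)
Require Import Defs.
From mathcomp Require Import all_boot all_order all_algebra.
From mathcomp Require Import complex.
From mathcomp Require Import classical_sets reals trigo.
From mathcomp Require Import ring.

(** All three symmetries are instances of one principle, [is_greedy_transport].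
    Let [f] be an additive isometry of the plane and let [s_n] be signs such
    that the n-th step vector of the new rotation is [s_n * f u], where [u] is
    that of the old one. Then the new candidates [f w + e' * (s_n * f u)] are
    the images under [f] of the old ones [w + e * u] through [e' = e * s_n], so
    norms, ties and minimizing signs correspond, and the new sequence is the
    image of the old one, with each sign multiplied by [s_n].

    The signs [s_n] come from the step vectors being the characters
    [n |-> (e^{2 pi i alpha})^n]: negating [alpha] conjugates them, adding an
    integer leaves them unchanged and adding 1/2 multiplies them by [(-1)^n].
    So [1 - alpha] calls for the conjugation and [s_n = 1], a shift of [alpha]
    by a half for the identity and [s_n = (-1)^n], and the opposite starting
    point for [w |-> -w] and [s_n = -1].

    The new parameters stay irrational because they differ from [alpha] or
    [-alpha] by rationals; this is also why a reduction mod 1, being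
    irrational, is nonzero and hence positive. *)

Set Implicit Arguments.
Unset Strict Implicit.
Unset Printing Implicit Defensive.

Import Order.TTheory GRing.Theory Num.Theory.

(* Imported again so that [rot] is the step vector, not list rotation. *)
Import Defs.

Local Open Scope ring_scope.
Local Open Scope complex_scope.

Lemma expiD (R : realType) (s t : R) : expi (s + t) = expi s * expi t.
Proof.
by apply/eqP; rewrite /expi cosD sinD eq_complex /= eqxx addrC mulrC
  [sin t * _]mulrC eqxx.
Qed.

Lemma expiN (R : realType) (t : R) : expi (- t) = conjc (expi t).
Proof. by rewrite /expi cosN sinN. Qed.

Lemma expi0 (R : realType) : expi (0 : R) = 1.
Proof. by rewrite /expi cos0 sin0. Qed.

Lemma expiMn (R : realType) (t : R) (n : nat) : expi (t *+ n) = expi t ^+ n.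
Proof. by elim: n => [|n IH]; rewrite ?mulr0n ?expi0 // mulrS exprS expiD IH. Qed.

Lemma expi_pi (R : realType) : expi (pi : R) = -1.
Proof. by apply/eqP; rewrite /expi cospi sinpi eq_complex /= oppr0 !eqxx. Qed.

Lemma rotN (R : realType) (alpha : R) n : rot (- alpha) n = conjc (rot alpha n).
Proof. by rewrite /rot -expiN; congr expi; ring. Qed.

Lemma rotD (R : realType) (alpha beta : R) n :
  rot (alpha + beta) n = rot alpha n * rot beta n.
Proof. by rewrite /rot -expiD; congr expi; ring. Qed.

Lemma rot_half (R : realType) n : rot (1 / 2 : R) n = (-1) ^+ n.
Proof. by rewrite /rot -expi_pi -expiMn; congr expi; rewrite -mulr_natr; field. Qed.

Lemma rot_nat (R : realType) (m n : nat) : rot (m%:R : R) n = 1.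
Proof.
rewrite /rot.
have -> : 2 * pi * m%:R * n%:R = (pi : R) *+ (2 * (m * n)).
  by rewrite -[RHS]mulr_natr !natrM; ring.
by rewrite expiMn expi_pi exprM sqrrN !expr1n.
Qed.

Lemma rot_int (R : realType) (m : int) n : rot (m%:~R : R) n = 1.
Proof.
case: m => m; first exact: rot_nat.
by rewrite NegzE mulrNz rotN rot_nat conjc1.
Qed.

Lemma rot_mod1 (R : realType) (alpha : R) n : rot (mod1 alpha) n = rot alpha n.
Proof. by rewrite /mod1 -mulrNz rotD rot_int mulr1. Qed.

Lemma irrationalN (R : realType) (x : R) : irrational x -> irrational (- x).
Proof.
move=> xirr [q _ qE]; apply: xirr; exists (- q) => //.
by rewrite rmorphN /= qE opprK.
Qed.

Lemma irrationalDrat (R : realType) (x : R) (q : rat) :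
  irrational x -> irrational (x + ratr q).
Proof.
move=> xirr [r _ rE]; apply: xirr; exists (r - q) => //.
by rewrite rmorphB /= rE addrK.
Qed.

Lemma irrational_mod1 (R : realType) (x : R) :
  irrational x -> irrational (mod1 x).
Proof. by move/(irrationalDrat (q := (- Num.floor x)%:~R)); rewrite ratr_int mulrNz. Qed.

Lemma mod1_gt0 (R : realType) (x : R) : irrational x -> 0 < mod1 x.
Proof.
move=> xirr; rewrite lt_neqAle subr_ge0 Num.Theory.floor_le andbT.
apply/eqP => E; apply: (irrational_mod1 xirr).
by exists 0; rewrite // rmorph0.
Qed.

(** The factor [s] occurs twice on the left, in the sign and in the step vector,
    and squares to 1: this is why signs get multiplied by [s]. *)
Lemma candidate_transport (R : realType) (f : {additive R[i] -> R[i]})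
    (s : int) (w u : R[i]) (e : int) :
  s \in [:: 1; -1] ->
  f w + (e * s)%:~R * (s%:~R * f u) = f (w + e%:~R * u).
Proof.
move=> sP; have s2 : s * s = 1 by move: sP; rewrite !inE => /orP[]/eqP->.
by rewrite mulrA -intrM -mulrA s2 mulr1 raddfD !mulrzl raddfMz.
Qed.

Lemma sign_mul (e s : int) :
  e \in [:: 1; -1] -> s \in [:: 1; -1] -> e * s \in [:: 1; -1].
Proof. by rewrite !inE => /orP[]/eqP-> /orP[]/eqP->. Qed.

(** One step of the transport principle. The isometry [f] preserves every
    comparison of candidates, and [e |-> e * s] is a bijection of the signs. *)
Lemma greedy_step_transport (R : realType) (f : {additive R[i] -> R[i]})
    (s : int) (w u : R[i]) zn en :
  (forall x, `|f x| = `|x|) -> s \in [:: 1; -1] -> greedy_step w u zn en ->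
  greedy_step (f w) (s%:~R * f u) (omap f zn) (omap (fun e => e * s) en).
Proof.
move=> normf sP; have C e := candidate_transport f w u e sP.
(* A change of [s] only swaps the two candidates, which preserves ties. *)
have tie : `|f w + s%:~R * f u| = `|f w - s%:~R * f u| <-> `|w + u| = `|w - u|.
  have P : `|f w + f u| = `|w + u| by rewrite -raddfD normf.
  have N : `|f w - f u| = `|w - u| by rewrite -raddfB normf.
  move: sP; rewrite !inE => /orP[]/eqP->; first by rewrite mul1r P N.
  by rewrite mulrNz mulN1r opprK P N; split=> ->.
case=> [[E [-> ->]]|[E [e [[eP emin] -> ->]]]]; first by left; split; first exact/tie.
right; split; first by move/tie.
exists (e * s); split=> //=; last by rewrite C.
split=> [|e' e'P]; first exact: sign_mul.
(* Every sign [e'] of the new step is of the form [e0 * s], as [s * s = 1]. *)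
have e'E : e' = (e' * s) * s.
  by move: sP; rewrite !inE => /orP[]/eqP->; rewrite ?mulr1 // !mulrN1 opprK.
by rewrite e'E !C !normf; apply: emin; apply: sign_mul.
Qed.

(** The images [z'] and [eps'] are given pointwise, so that the lemma also covers
    sequences that agree with [omap f] only extensionally, such as those obtained
    from the identity or from constant signs. *)
Lemma is_greedy_transport (R : realType) (f : {additive R[i] -> R[i]})
    (s : nat -> int) (alpha beta : R) zm1 z eps z' eps' :
  0 < beta -> irrational beta ->
  (forall x, `|f x| = `|x|) -> (forall n, s n \in [:: 1; -1]) ->
  (forall n, rot beta n = (s n)%:~R * f (rot alpha n)) ->
  (forall n, z' n = omap f (z n)) ->
  (forall n, eps' n = omap (fun e => e * s n) (eps n)) ->
  is_greedy alpha zm1 z eps -> is_greedy beta (f zm1) z' eps'.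
Proof.
move=> b0 birr normf sP rotE zE epsE [_ _ h]; split=> // n.
have -> : pred_term (f zm1) z' n = omap f (pred_term zm1 z n) by case: n => /=.
rewrite rotE zE epsE; move: (h n); case: (pred_term _ _ _) => [w|] /=.
  exact: greedy_step_transport.
by move=> [-> ->].
Qed.

Lemma normc_conjc (R : realType) (x : R[i]) : `|conjc x| = `|x|.
Proof. by rewrite !normc_def; case: x => a b /=; rewrite sqrrN. Qed.

(** Alternating the direction of the step vector leaves the pair of candidates
    unchanged and only exchanges their signs at odd times. Both shifts by a half
    fall under this case: they differ by 1, hence have the same step vectors. *)
Lemma is_greedy_mod1_alternating (R : realType) (alpha beta : R) zm1 z eps :
  irrational beta -> (forall n, rot beta n = (-1) ^+ n * rot alpha n) ->
  is_greedy alpha zm1 z eps ->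
  is_greedy (mod1 beta) zm1 z
    (fun n => omap (fun e : int => e * (-1) ^+ n) (eps n)).
Proof.
move=> birr rotE.
apply: (@is_greedy_transport _ idfun (fun n => (-1) ^+ n)) => //.
- exact: mod1_gt0.
- exact: irrational_mod1.
- by move=> n; rewrite -signr_odd; case: odd.
- by move=> n; rewrite rot_mod1 rotE rmorphXn rmorphN1.
- by move=> n; case: (z n).
Qed.

Theorem proposition2 (R : realType) (alpha : R) (zm1 : R[i])
    (z : nat -> option R[i]) (eps : nat -> option int)
    (alpha_gt0 : 0 < alpha) (alpha_lt1 : alpha < 1)
    (alpha_irr : irrational alpha)
    (greedy_z : is_greedy alpha zm1 z eps) :
  [/\ is_greedy (1 - alpha) (conjc zm1)
        (fun n => omap conjc (z n)) eps,
      is_greedy (mod1 (alpha + 1 / 2)) zm1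
        z (fun n => omap (fun e : int => e * (-1) ^+ n) (eps n)),
      is_greedy (mod1 (alpha - 1 / 2)) zm1
        z (fun n => omap (fun e : int => e * (-1) ^+ n) (eps n))
    & is_greedy alpha (- zm1)
        (fun n => omap (fun w : R[i] => - w) (z n))
        (fun n => omap (fun e : int => - e) (eps n))].
Proof.
have half_irr : irrational (alpha + 1 / 2).
  have := irrationalDrat (q := 1 / 2) alpha_irr.
  by rewrite fmorph_div rmorph1 rmorph_nat.
have rot_half_shift n : rot (alpha + 1 / 2) n = (-1) ^+ n * rot alpha n.
  by rewrite rotD rot_half mulrC.
have minus_halfE : alpha - 1 / 2 = alpha + 1 / 2 + (-1)%:~R.
  by rewrite mulrNz; field.
split.
- apply: (is_greedy_transport (f := conjc) (s := fun=> 1)) greedy_z => //.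
  + by rewrite subr_gt0.
  + have := irrationalDrat (q := 1) (irrationalN alpha_irr).
    by rewrite rmorph1 addrC.
  + exact: normc_conjc.
  + by move=> n; rewrite mul1r rotD (rot_int R 1) rotN mul1r.
  + by move=> n; case: (eps n) => //= e; rewrite mulr1.
- exact: is_greedy_mod1_alternating greedy_z.
- apply: is_greedy_mod1_alternating greedy_z => [|n].
    by have := irrationalDrat (q := (-1)%:~R) half_irr; rewrite minus_halfE ratr_int.
  by rewrite minus_halfE rotD rot_int mulr1.
- apply: (is_greedy_transport (f := GRing.opp) (s := fun=> -1)) greedy_z => //.
  + exact: normrN.
  + by move=> n; rewrite mulrNz mulN1r opprK.
  + by move=> n; case: (eps n) => //= e; rewrite mulrN1.
Qed.
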